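(* Let $m\ge1$ and let $\alpha_1,\dots,\alpha_m$ be positive constants. Fix $r>0$ such that $q:=r\max_{1\le i\le m}\alpha_i<1$. For each $i\in\{1,\dots,m\}$ define $G_i:[0,r]\to[0,r]$ by $G_i(s)=\alpha_i s^2$. Then the following hold. (i) Each $G_i$ maps $[0,r]$ into itself. (ii) For every itinerary $(i_k)_{k\ge0}\in\{1,\dots,m\}^{\mathbb{N}}$ and every initial value $s_0\in[0,r]$, the sequence defined by $s_{k+1}=G_{i_k}(s_k)=\alpha_{i_k}s_k^2$ is well defined for all $k\ge0$, remains in $[0,r]$, and converges to $0$. (iii) More precisely, for all $n\ge1$, $$s_n=\alpha_{i_{n-1}}\,\alpha_{i_{n-2}}^{2}\,\alpha_{i_{n-3}}^{2^2}\cdots\alpha_{i_0}^{2^{n-1}}\,s_0^{2^n},$$ and one has the uniform estimate $$s_n\le r\,q^{2^n-1}.$$ In particular, the convergence to $0$ is double-exponential. (iv) In the logarithmic coordinates $u_k:=-\log s_k$ (for $s_k>0$), the dynamics becomes affine: $$u_{k+1}=2u_k-\log\alpha_{i_k}.$$ Equivalently, the inverse branches are the contractions $$F_i(u)=\frac{u+\log\alpha_i}{2},\qquad i=1,\dots,m,$$ each of Lipschitz constant $1/2$. (v) If all coefficients coincide, i.e. $\alpha_1=\cdots=\alpha_m=\alpha$, then every forward orbit satisfies $$s_{n+1}=\alpha s_n^2,\qquad s_n=\alpha^{2^n-1}s_0^{2^n},$$ and hence $$-\log s_n=2^n(-\log s_0)-(2^n-1)\log\alpha.$$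
   Context: $\mathbb{N}=\{0,1,2,\dots\}$. The logarithmic identities are for orbits with $s_0>0$. *)

(* Defs.v *)
From HB Require Import structures.
From mathcomp Require Import all_boot all_order all_algebra.
From mathcomp Require Import all_classical all_reals all_analysis.
Set Implicit Arguments.
Unset Strict Implicit.
Unset Printing Implicit Defensive.
Import Order.TTheory GRing.Theory Num.Theory.
Import numFieldNormedType.Exports.
Local Open Scope classical_set_scope.
Local Open Scope ring_scope.

Section QuadraticBranches.
Context {R : realType} {m : nat}.
Implicit Types (alpha : 'I_m -> R) (i : 'I_m) (itin : nat -> 'I_m).

(* G_i is given by its formula on all of R; that it restricts to a self-map
   of [0, r] is a claim of the theorem. *)
Definition G alpha i (s : R) : R := alpha i * s ^+ 2.

Definition is_orbit alpha itin (s0 : R) (s : nat -> R) : Prop :=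
  s 0%N = s0 /\ forall k, s k.+1 = G alpha (itin k) (s k).

(* G_i conjugated by the change of coordinates u = - log s, s = exp (- u). *)
Definition logG alpha i (u : R) : R := - ln (G alpha i (expR (- u))).

Definition F alpha i (u : R) : R := (u + ln (alpha i)) / 2.

End QuadraticBranches.

(* Convergence to 0 at a double-exponential rate: C * exp (- a * 2 ^ n), with
   c = exp (- a) for some a > 0. *)
Definition double_exp_cvg0 {R : realType} (s : nat -> R) : Prop :=
  exists C c : R, [/\ 0 < C, 0 < c < 1 &
    forall n, `|s n| <= C * c ^+ (2 ^ n)].

(* Main.v *)
Require Import Defs.
From HB Require Import structures.
From mathcomp Require Import all_boot all_order all_algebra.
From mathcomp Require Import all_classical all_reals all_analysis.
From mathcomp Require Import ring zify.
Set Implicit Arguments.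
Unset Strict Implicit.
Unset Printing Implicit Defensive.
Import Order.TTheory GRing.Theory Num.Theory.
Import numFieldNormedType.Exports.
Local Open Scope classical_set_scope.
Local Open Scope ring_scope.

(** Write M for the largest coefficient, so that q = r * M.  Rescaling by M
    turns every branch s |-> alpha_i * s ^ 2 into a map lying below the plain
    squaring t |-> t ^ 2, t = M * s: whatever the itinerary, M * s_n is at most
    (M * s_0) ^ (2 ^ n), and M * s_0 <= q < 1.  This is the uniform
    double-exponential estimate ([orbit_le_double_exp]), and convergence to 0
    follows from it ([double_exp_cvg0_cvg]).  The bound on the range is the
    first step of the same comparison: M * r ^ 2 = q * r <= r ([G_itv]).

    The closed form ([orbit_closed_form]) records that a coefficient used at
    time k is squared by each later step.  Minus the logarithm turns products
    into sums and squaring into doubling, so a branch becomes the affine map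
    u |-> 2 * u - log alpha_i ([neg_ln_quadratic]); its inverse divides every
    distance by exactly 2 ([dist_F]), which makes 1/2 the best Lipschitz
    constant. *)

(** * Closed forms *)

Fixpoint orbit (R : realType) (m : nat) (alpha : 'I_m -> R)
    (itin : nat -> 'I_m) (s0 : R) (n : nat) : R :=
  if n is k.+1 then G alpha (itin k) (orbit alpha itin s0 k) else s0.

Lemma orbit_exists_unique (R : realType) (m : nat) (alpha : 'I_m -> R)
    (itin : nat -> 'I_m) (s0 : R) :
  exists! s : nat -> R, is_orbit alpha itin s0 s.
Proof.
exists (orbit alpha itin s0); split; first by split.
move=> s [s_0 s_S]; apply/funext; elim=> [|k IHk]; first by rewrite s_0.
by rewrite s_S -IHk.
Qed.

(** The exponent of the coefficient used [j.+1] steps ago is [2 ^ j]: one more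
    step squares everything present and brings in a new coefficient with
    exponent 1, which becomes the factor of index [j = 0]. *)
Lemma orbit_closed_form (R : realType) (m : nat) (alpha : 'I_m -> R)
    (itin : nat -> 'I_m) (s0 : R) (s : nat -> R) (n : nat) :
  is_orbit alpha itin s0 s ->
  s n = (\prod_(j < n) alpha (itin (n - j.+1)%N) ^+ (2 ^ j)) * s0 ^+ (2 ^ n).
Proof.
move=> [s_0 s_S]; elim: n => [|n IHn]; first by rewrite big_ord0 mul1r expr1.
rewrite s_S IHn /G big_ord_recl expr1 subn1 /= -mulrA; congr (_ * _).
rewrite exprMn -exprM -expnSr; congr (_ * _).
rewrite -prodrXl; apply: eq_bigr => j _.
by rewrite -exprM -expnSr /bump /= add1n subSS.
Qed.

Lemma double_pred_exp2 (n : nat) : ((2 ^ n.+1 - 1) = (2 ^ n - 1) * 2 + 1)%N.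
Proof. by have := expn_gt0 2 n; rewrite expnS; lia. Qed.

Lemma orbit_const_closed_form (R : realType) (m : nat) (alpha : 'I_m -> R)
    (a : R) (itin : nat -> 'I_m) (s0 : R) (s : nat -> R) (n : nat) :
  (forall i, alpha i = a) -> is_orbit alpha itin s0 s ->
  s n = a ^+ (2 ^ n - 1) * s0 ^+ (2 ^ n).
Proof.
move=> alphaE [s_0 s_S]; elim: n => [|n IHn].
  by rewrite subnn expr0 mul1r expr1.
rewrite s_S IHn /G alphaE exprMn -!exprM -expnSr double_pred_exp2.
by rewrite addn1 exprS mulrA.
Qed.

(** * Bounds and convergence *)

Lemma G_ge0 (R : realType) (m : nat) (alpha : 'I_m -> R) (i : 'I_m) (s : R) :
  0 < alpha i -> 0 <= G alpha i s.
Proof. by move=> ai; rewrite mulr_ge0 ?sqr_ge0 ?ltW. Qed.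

(** Squaring is monotone on nonnegative numbers, so the worst case is the
    largest coefficient at the largest point. *)
Lemma G_le (R : realType) (m : nat) (alpha : 'I_m -> R) (i : 'I_m)
    (M s b : R) :
  0 < alpha i <= M -> 0 <= s <= b -> G alpha i s <= M * b ^+ 2.
Proof.
move=> /andP[ai aM] /andP[s0 sb].
by rewrite ler_pM ?sqr_ge0 ?(ltW ai)// lerXn2r// nnegrE ?(le_trans s0 sb).
Qed.

Lemma G_itv (R : realType) (m : nat) (alpha : 'I_m -> R) (i : 'I_m)
    (M r s : R) :
  0 < alpha i <= M -> 0 < r -> r * M <= 1 ->
  s \in `[0, r] -> G alpha i s \in `[0, r].
Proof.
move=> aM r0 rM; rewrite !in_itv/= => sr; rewrite G_ge0; last by case/andP: aM.
rewrite (le_trans (G_le aM sr))// expr2 mulrA (mulrC M).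
by rewrite -[leRHS]mul1r ler_wpM2r// ltW.
Qed.

Lemma orbit_itv (R : realType) (m : nat) (alpha : 'I_m -> R)
    (M r : R) (itin : nat -> 'I_m) (s0 : R) (s : nat -> R) (k : nat) :
  (forall i, 0 < alpha i <= M) -> 0 < r -> r * M <= 1 ->
  s0 \in `[0, r] -> is_orbit alpha itin s0 s -> s k \in `[0, r].
Proof.
move=> aM r0 rM s0r [s_0 s_S]; elim: k => [|k IHk]; first by rewrite s_0.
by rewrite s_S (G_itv (aM _) r0 rM).
Qed.

(** One step sends the bound [r * q ^ (2 ^ n - 1)] to [M] times its square, and
    the factor [r * M = q] produced there supplies the odd unit in
    [2 ^ n.+1 - 1 = 2 * (2 ^ n - 1) + 1]. *)
Lemma orbit_le_double_exp (R : realType) (m : nat) (alpha : 'I_m -> R)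
    (M r : R) (itin : nat -> 'I_m) (s0 : R) (s : nat -> R) (n : nat) :
  (forall i, 0 < alpha i <= M) -> s0 \in `[0, r] ->
  is_orbit alpha itin s0 s ->
  0 <= s n <= r * (r * M) ^+ (2 ^ n - 1).
Proof.
move=> aM; rewrite in_itv/= => s0r [s_0 s_S]; elim: n => [|n IHn].
  by rewrite s_0 subnn expr0 mulr1.
rewrite s_S G_ge0; last by case/andP: (aM (itin n)).
rewrite (le_trans (G_le (aM _) IHn))// double_pred_exp2 exprD expr1 exprM.
by rewrite le_eqVlt; apply/orP; left; apply/eqP; ring.
Qed.

(** Since [n <= 2 ^ n], the double-exponential bound is below the geometric
    sequence [C * c ^ n]. *)
Lemma double_exp_cvg0_cvg (R : realType) (s : nat -> R) :
  double_exp_cvg0 s -> s @ \oo --> (0 : R).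
Proof.
move=> [C [c [C0 /andP[c0 c1] sC]]]; apply/norm_cvg0P.
apply: (@squeeze_cvgr _ _ _ _ (fun=> 0) (fun n => C * c ^+ n)).
- apply: nearW => n; rewrite normr_ge0 (le_trans (sC n))// ler_pM2l//.
  by rewrite ler_wiXn2l ?(ltW c0) ?(ltW c1)// ltnW// ltn_expl.
- exact: cvg_cst.
- rewrite -[X in _ --> X](mulr0 C); apply: cvgMr.
  by apply: cvg_expr; rewrite ger0_norm ?(ltW c0).
Qed.

Lemma orbit_double_exp_cvg0 (R : realType) (m : nat) (alpha : 'I_m -> R)
    (M r : R) (itin : nat -> 'I_m) (s0 : R) (s : nat -> R) :
  (forall i, 0 < alpha i <= M) -> 0 < r -> r * M < 1 ->
  s0 \in `[0, r] -> is_orbit alpha itin s0 s -> double_exp_cvg0 s.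
Proof.
move=> aM r0 rM1 s0r os.
have M0 : 0 < M by case/andP: (aM (itin 0%N)) => /lt_le_trans; apply.
have rM0 : 0 < r * M by rewrite mulr_gt0.
(* r * q ^ (2 ^ n - 1) = (r / q) * q ^ (2 ^ n), and r / q = M^-1. *)
exists M^-1, (r * M); split; [by rewrite invr_gt0 | by rewrite rM0 |] => n.
have /andP[sn0 sn] := orbit_le_double_exp n aM s0r os.
rewrite ger0_norm// (le_trans sn)//.
have -> : (2 ^ n = (2 ^ n - 1).+1)%N by rewrite subn1 prednK// expn_gt0.
rewrite subn1 /= exprS le_eqVlt; apply/orP; left; apply/eqP.
by field; rewrite gt_eqF.
Qed.

(** * Logarithmic coordinates *)

Lemma neg_ln_quadratic (R : realType) (a s : R) :
  0 < a -> 0 < s -> - ln (a * s ^+ 2) = 2 * (- ln s) - ln a.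
Proof.
by move=> a0 s0; rewrite lnM ?posrE ?exprn_gt0// lnXn// mulr2n; ring.
Qed.

Lemma orbit_gt0 (R : realType) (m : nat) (alpha : 'I_m -> R)
    (itin : nat -> 'I_m) (s0 : R) (s : nat -> R) (k : nat) :
  (forall i, 0 < alpha i) -> 0 < s0 -> is_orbit alpha itin s0 s -> 0 < s k.
Proof.
move=> a0 s0_gt0 [s_0 s_S]; elim: k => [|k IHk]; first by rewrite s_0.
by rewrite s_S mulr_gt0 ?exprn_gt0.
Qed.

Lemma logG_affine (R : realType) (m : nat) (alpha : 'I_m -> R) (i : 'I_m)
    (u : R) :
  0 < alpha i -> logG alpha i u = 2 * u - ln (alpha i).
Proof.
by move=> a0; rewrite /logG /G neg_ln_quadratic ?expR_gt0// expRK opprK.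
Qed.

Lemma dist_F (R : realType) (m : nat) (alpha : 'I_m -> R) (i : 'I_m)
    (u v : R) :
  `|F alpha i u - F alpha i v| = 2^-1 * `|u - v|.
Proof.
have -> : F alpha i u - F alpha i v = 2^-1 * (u - v) by rewrite /F; field.
by rewrite normrM ger0_norm.
Qed.

Lemma F_contraction (R : realType) (m : nat) (alpha : 'I_m -> R) (i : 'I_m) :
  contraction (2^-1)%:nng (totalfun (F alpha i)).
Proof.
split; first by rewrite /= invf_lt1// ltr1n.
by move=> [u v] _ /=; rewrite dist_F.
Qed.

Lemma F_lipschitz_ge (R : realType) (m : nat) (alpha : 'I_m -> R) (i : 'I_m)
    (k : R) :
  k.-lipschitz (F alpha i) -> 2^-1 <= k.
Proof.
move=> /(_ (1, 0)) /= /(_ (conj I I)).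
by rewrite dist_F subr0 normr1 !mulr1.
Qed.

(* The alpha i are positive and 0 < m, so the big maximum with default value 0
   is their maximum. *)
Theorem theorem3p1 (R : realType) (m : nat) (hm : (1 <= m)%N)
    (alpha : 'I_m -> R) (halpha : forall i, 0 < alpha i)
    (r : R) (hr : 0 < r)
    (q : R) (hq : q = r * \big[Num.max/0]_(i < m) alpha i) (hq1 : q < 1) :
  (* (i) *)
  (forall (i : 'I_m) (s : R), s \in `[0, r] -> G alpha i s \in `[0, r]) /\
  (* (ii) *)
  (forall (itin : nat -> 'I_m) (s0 : R), s0 \in `[0, r] ->
     (exists! s : nat -> R, is_orbit alpha itin s0 s) /\
     (forall s : nat -> R, is_orbit alpha itin s0 s ->
        (forall k, s k \in `[0, r]) /\ s @ \oo --> (0 : R))) /\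
  (* (iii) *)
  (forall (itin : nat -> 'I_m) (s0 : R) (s : nat -> R),
     s0 \in `[0, r] -> is_orbit alpha itin s0 s ->
     (forall n, (1 <= n)%N ->
        s n = (\prod_(j < n) alpha (itin (n - j.+1)%N) ^+ (2 ^ j)) *
                s0 ^+ (2 ^ n) /\
        s n <= r * q ^+ (2 ^ n - 1)) /\
     double_exp_cvg0 s) /\
  (* (iv) *)
  ((forall (itin : nat -> 'I_m) (s0 : R) (s : nat -> R),
      s0 \in `[0, r] -> 0 < s0 -> is_orbit alpha itin s0 s ->
      forall k, [/\ 0 < s k,
        - ln (s k.+1) = 2 * (- ln (s k)) - ln (alpha (itin k)) &
        - ln (s k) = F alpha (itin k) (- ln (s k.+1))]) /\
   (forall i : 'I_m,
      [/\ (forall u : R, logG alpha i u = 2 * u - ln (alpha i)),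
          cancel (logG alpha i) (F alpha i),
          cancel (F alpha i) (logG alpha i),
          contraction (2^-1)%:nng (totalfun (F alpha i)) &
          (forall k : R, k.-lipschitz (F alpha i) -> 2^-1 <= k)])) /\
  (* (v) *)
  (forall a : R, (forall i, alpha i = a) ->
     forall (itin : nat -> 'I_m) (s0 : R) (s : nat -> R),
     s0 \in `[0, r] -> is_orbit alpha itin s0 s ->
     forall n,
       [/\ s n.+1 = a * s n ^+ 2,
           s n = a ^+ (2 ^ n - 1) * s0 ^+ (2 ^ n) &
           (0 < s0 ->
            - ln (s n) = 2 ^+ n * (- ln s0) - (2 ^+ n - 1) * ln a)]).
Proof.
have aM i : 0 < alpha i <= \big[Num.max/0]_(i < m) alpha i.
  by rewrite halpha le_bigmax.
have rM1 : r * \big[Num.max/0]_(i < m) alpha i < 1 by rewrite -hq.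
split; [|split; [|split; [|split; [split|]]]].
- by move=> i s; apply: (G_itv (aM i) hr (ltW rM1)).
- move=> itin s0 s0r; split; first exact: orbit_exists_unique.
  move=> s os; split=> [k|]; first exact: (orbit_itv k aM hr (ltW rM1) s0r os).
  by apply: double_exp_cvg0_cvg; exact: (orbit_double_exp_cvg0 aM hr rM1 s0r os).
- move=> itin s0 s s0r os; split; last first.
    exact: (orbit_double_exp_cvg0 aM hr rM1 s0r os).
  move=> n _; split; first exact: (orbit_closed_form n os).
  by rewrite hq; have /andP[] := orbit_le_double_exp n aM s0r os.
- move=> itin s0 s s0r s0_gt0 os k.
  have sk := orbit_gt0 k halpha s0_gt0 os.
  have step : - ln (s k.+1) = 2 * (- ln (s k)) - ln (alpha (itin k)).
    by case: os => _ ->; rewrite /G neg_ln_quadratic.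
  by split=> //; rewrite step /F; field.
- move=> i; split.
  + by move=> u; rewrite logG_affine.
  + by move=> u; rewrite logG_affine// /F; field.
  + by move=> u; rewrite logG_affine// /F; field.
  + exact: F_contraction.
  + by move=> k Fk; exact: (F_lipschitz_ge Fk).
- move=> a alphaE itin s0 s s0r os n.
  have sn := orbit_const_closed_form n alphaE os.
  split=> //; first by case: os => _ ->; rewrite /G alphaE.
  have a0 : 0 < a by rewrite -(alphaE (itin 0%N)).
  move=> s0_gt0; rewrite sn lnM ?posrE ?exprn_gt0// !lnXn//.
  rewrite -(mulr_natl (ln a)) -(mulr_natl (ln s0)) natrB ?expn_gt0// natrX.
  by ring.
Qed.
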